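(* Consider Problem A (minimax MPC without saturation in storage and conventional units) and Problem B (minimax MPC with saturation), defined in the context, with the same data, bounds and initial conditions. Then any feasible solution $(\boldsymbol\delta_{\mathrm t},\mathbf u)$ of Problem A is a feasible solution of Problem B. The converse does not hold in general, i.e. there are instances in which some feasible solution of Problem B is not a feasible solution of Problem A. Furthermore, a solution $(\boldsymbol\delta_{\mathrm t},\mathbf u)$ that is feasible for both Problem A and Problem B is associated with the same cost value in both problems.
   Context: Conventions. All comparisons, minima, maxima, absolute values of vectors or matrices are elementwise; $[a,b]$ denotes the box $\{z: a\le z\le b\}$; $\mathbf 1^{\mathsf T}z=\sum_i z_i$. For $\delta\in\{0,1\}$, $z\in\mathbb R$: $\delta\wedge z=z$ if $\delta=1$ and $0$ if $\delta=0$ (elementwise for vectors). For $a\le b$: $\mathrm{sat}(a,z,b)=a$ if $z<a$, $=z$ if $z\in[a,b]$, $=b$ if $z>b$ (elementwise for vectors). Data. $T,S,R,D$ are the numbers of conventional units, storage units, renewable units and loads; $N_p\in\mathbb N$ is the prediction horizon, $\mathrm T_{\mathrm s}>0$ the sampling time, $k$ a fixed time instant. Droop gains $\chi_{\mathrm t}\in\mathbb R_{\ge0}^T$, $\chi_{\mathrm s}\in\mathbb R_{\ge0}^S$, $\chi_{\mathrm r}\in\mathbb R_{\ge0}^R$. Power limits $p^{\min}=(p_{\mathrm t}^{\min},p_{\mathrm s}^{\min},p_{\mathrm r}^{\min})\in\mathbb R_{\ge0}^T\times\mathbb R_{<0}^S\times\mathbb R_{\ge0}^R$ and $p^{\max}=(p_{\mathrm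 t}^{\max},p_{\mathrm s}^{\max},p_{\mathrm r}^{\max})\in\mathbb R_{>0}^{T+S+R}$, $p^{\min}\le p^{\max}$. Energy limits $x^{\min}\in\mathbb R_{\ge0}^S$, $x^{\max}\in\mathbb R_{>0}^S$, $x^{\min}\le x^{\max}$. Set-point limits $u^{\min}\le u^{\max}$ in $\mathbb R^{T+S+R}$. Initial conditions $x(k)=x_{\mathrm s,0}\in[x^{\min},x^{\max}]$, $\delta_{\mathrm t}(k)=\delta_{\mathrm t,0}\in\{0,1\}^T$. Variables, for $j=1,\dots,N_p$. Set-points $u(k+j)=(u_{\mathrm t},u_{\mathrm s},u_{\mathrm r})(k+j)\in\mathbb R^{T}\times\mathbb R^S\times\mathbb R^R$; switch statuses $\delta_{\mathrm t}(k+j)\in\{0,1\}^T$; disturbances $w(k+j)=(w_{\mathrm r},w_{\mathrm d})(k+j)$ with $w_{\mathrm r}\in\mathbb R_{\ge0}^R$ (available renewable infeed), $w_{\mathrm d}\in\mathbb R_{\le0}^D$ (load); unit powers $p(k+j)=(p_{\mathrm t},p_{\mathrm s},p_{\mathrm r})(k+j)$; stored energies $x(k+j)\in\mathbb R^S$; auxiliary free scalar $\rho(k+j)\in\mathbb R$. Bold symbols $\boldsymbol\delta_{\mathrm t},\mathbf u,\mathbf w,\mathbf p$ denote the matrices whose columns are the values at $k+1,\dots,k+N_p$; $\mathbf w^{\min}\le\mathbf w^{\max}$ are given disturbance bounds (also of this sign type), with renewable part satisfying $w_{\mathrm r}^{\min}(k+j)\ge p_{\mathrm r}^{\min}$ so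 that the saturation below is well-defined. Cost. With $C_{\mathrm t},C_{\mathrm{on}},C_{\mathrm{sw}}\in\mathbb R_{\ge0}^T$, $C_{\mathrm s}\in\mathbb R_{\ge0}^S$, $$J(\mathbf p,\boldsymbol\delta_{\mathrm t},\delta_{\mathrm t}(k))=\sum_{j=1}^{N_p}\Big(C_{\mathrm t}^{\mathsf T}p_{\mathrm t}(k+j)+C_{\mathrm{on}}^{\mathsf T}\delta_{\mathrm t}(k+j)+C_{\mathrm{sw}}^{\mathsf T}|\delta_{\mathrm t}(k+j)-\delta_{\mathrm t}(k+j-1)|+C_{\mathrm s}^{\mathsf T}p_{\mathrm s}(k+j)\Big).$$ In both problems one minimizes over $(\boldsymbol\delta_{\mathrm t},\mathbf u)$, with $\boldsymbol\delta_{\mathrm t}\in\{0,1\}^{T\times N_p}$ and all columns of $\mathbf u$ in $[u^{\min},u^{\max}]$, the worst-case cost $\max_{\mathbf w\in[\mathbf w^{\min},\mathbf w^{\max}]}J$. The pair $(\boldsymbol\delta_{\mathrm t},\mathbf u)$ is a feasible solution if for every $\mathbf w\in[\mathbf w^{\min},\mathbf w^{\max}]$ there exist $p(k+j),x(k+j),\rho(k+j)$, $j=1,\dots,N_p$, satisfying the constraints of the respective problem listed below (with the initial conditions); its cost value is $\max_{\mathbf w}J$ with $\mathbf p$ the resulting powers. Problem A constraints, $j=1,\dots,N_p$: $0=\mathbf 1^{\mathsf T}p(k+j)+\mathbf 1^{\mathsf T}w_{\mathrm d}(k+j)$; $p_{\mathrm r}(k+j)=\min(u_{\mathrm r}(k+j)+\chi_{\mathrm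 r}\rho(k+j),w_{\mathrm r}(k+j))$; $p_{\mathrm t}(k+j)=\delta_{\mathrm t}(k+j)\wedge(u_{\mathrm t}(k+j)+\chi_{\mathrm t}\rho(k+j))$; $p_{\mathrm s}(k+j)=u_{\mathrm s}(k+j)+\chi_{\mathrm s}\rho(k+j)$; $x(k+j)=x(k+j-1)-\mathrm T_{\mathrm s}p_{\mathrm s}(k+j)$; and the limits $\delta_{\mathrm t}(k+j)\wedge p_{\mathrm t}^{\min}\le p_{\mathrm t}(k+j)$, $p_{\mathrm s}^{\min}\le p_{\mathrm s}(k+j)$, $p_{\mathrm r}^{\min}\le p_{\mathrm r}(k+j)$, $p(k+j)\le p^{\max}$, $x^{\min}\le x(k+j)\le x^{\max}$. Problem B constraints, $j=1,\dots,N_p$: $0=\mathbf 1^{\mathsf T}p(k+j)+\mathbf 1^{\mathsf T}w_{\mathrm d}(k+j)$; $p_{\mathrm r}(k+j)=\mathrm{sat}(p_{\mathrm r}^{\min},u_{\mathrm r}(k+j)+\chi_{\mathrm r}\rho(k+j),w_{\mathrm r}(k+j))$; $p_{\mathrm t}(k+j)=\delta_{\mathrm t}(k+j)\wedge\mathrm{sat}(p_{\mathrm t}^{\min},u_{\mathrm t}(k+j)+\chi_{\mathrm t}\rho(k+j),p_{\mathrm t}^{\max})$; $\bar p_{\mathrm s}^{\min}(k+j)=\max(p_{\mathrm s}^{\min},(x(k+j-1)-x^{\max})/\mathrm T_{\mathrm s})$; $\bar p_{\mathrm s}^{\max}(k+j)=\min(p_{\mathrm s}^{\max},(x(k+j-1)-x^{\min})/\mathrm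 T_{\mathrm s})$; $p_{\mathrm s}(k+j)=\mathrm{sat}(\bar p_{\mathrm s}^{\min}(k+j),u_{\mathrm s}(k+j)+\chi_{\mathrm s}\rho(k+j),\bar p_{\mathrm s}^{\max}(k+j))$; $x(k+j)=x(k+j-1)-\mathrm T_{\mathrm s}p_{\mathrm s}(k+j)$. (No further power or energy limits are imposed.) *)

(* Defs.v *)
From HB Require Import structures.
From mathcomp Require Import all_boot all_order all_algebra.
From mathcomp Require Import all_classical all_reals.

Set Implicit Arguments.
Unset Strict Implicit.
Unset Printing Implicit Defensive.

Import Order.TTheory GRing.Theory Num.Theory.

Local Open Scope classical_set_scope.
Local Open Scope ring_scope.

Definition gate (K : nmodType) (b : bool) (z : K) : K := if b then z else 0.

(* Only meant for a <= b. *)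
Definition sat (K : numDomainType) (a z b : K) : K :=
  if z < a then a else if z <= b then z else b.

Definition lemx (K : numDomainType) m n (A B : 'M[K]_(m, n)) : Prop :=
  forall i j, A i j <= B i j.

Definition ltmx (K : numDomainType) m n (A B : 'M[K]_(m, n)) : Prop :=
  forall i j, A i j < B i j.

(* Column j : 'I_N of a trajectory M stands for time k + j + 1.  If a0 is the
   value at time k, column j of [delay a0 M] is the value at time k + j, i.e.
   one step before column j of M. *)
Definition delay (A : Type) m N (a0 : 'cV[A]_m) (M : 'M[A]_(m, N))
    : 'M[A]_(m, N) :=
  \matrix_(i, j) row_mx a0 M i (widen_ord (leqnSn N) j).

(* Block column (conventional, storage, renewable), with n columns. *)
Record units (K : Type) (nT nS nR n : nat) := Units {
  conv : 'M[K]_(nT, n);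
  stor : 'M[K]_(nS, n);
  ren : 'M[K]_(nR, n)
}.

Definition leu (K : numDomainType) nT nS nR n (a b : units K nT nS nR n) :=
  [/\ lemx (conv a) (conv b), lemx (stor a) (stor b) & lemx (ren a) (ren b)].

Definition ucol (K : Type) nT nS nR n (a : units K nT nS nR n) (j : 'I_n)
    : units K nT nS nR 1 :=
  Units (col j (conv a)) (col j (stor a)) (col j (ren a)).

Definition usum (K : nmodType) nT nS nR n (a : units K nT nS nR n) (j : 'I_n)
    : K :=
  \sum_i conv a i j + \sum_i stor a i j + \sum_i ren a i j.

Record disturbance (K : Type) (nR nD N : nat) := Disturbance {
  infeed : 'M[K]_(nR, N);
  load : 'M[K]_(nD, N)
}.

Definition lew (K : numDomainType) nR nD N (v w : disturbance K nR nD N) :=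
  lemx (infeed v) (infeed w) /\ lemx (load v) (load w).

Definition signed_disturbance (K : numDomainType) nR nD N
    (w : disturbance K nR nD N) :=
  lemx 0 (infeed w) /\ lemx (load w) 0.

Record mpc_data (K : Type) (nT nS nR nD N : nat) := MpcData {
  Ts : K;
  chi : units K nT nS nR 1;
  pmin : units K nT nS nR 1;
  pmax : units K nT nS nR 1;
  xmin : 'cV[K]_nS;
  xmax : 'cV[K]_nS;
  umin : units K nT nS nR 1;
  umax : units K nT nS nR 1;
  x0 : 'cV[K]_nS;
  delta0 : 'cV[bool]_nT;
  wmin : disturbance K nR nD N;
  wmax : disturbance K nR nD N;
  Ct : 'cV[K]_nT;
  Con : 'cV[K]_nT;
  Csw : 'cV[K]_nT;
  Cs : 'cV[K]_nS
}.

Section Problems.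
Variables (K : realType) (nT nS nR nD N : nat).
Variable d : mpc_data K nT nS nR nD N.

Record well_posed : Prop := WellPosed {
  Ts_gt0 : 0 < Ts d;
  chi_ge0 : leu (Units 0 0 0) (chi d);
  pmin_conv_ge0 : lemx 0 (conv (pmin d));
  pmin_stor_lt0 : ltmx (stor (pmin d)) 0;
  pmin_ren_ge0 : lemx 0 (ren (pmin d));
  pmax_conv_gt0 : ltmx 0 (conv (pmax d));
  pmax_stor_gt0 : ltmx 0 (stor (pmax d));
  pmax_ren_gt0 : ltmx 0 (ren (pmax d));
  pmin_le_pmax : leu (pmin d) (pmax d);
  xmin_ge0 : lemx 0 (xmin d);
  xmax_gt0 : ltmx 0 (xmax d);
  xmin_le_xmax : lemx (xmin d) (xmax d);
  umin_le_umax : leu (umin d) (umax d);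
  xmin_le_x0 : lemx (xmin d) (x0 d);
  x0_le_xmax : lemx (x0 d) (xmax d);
  wmin_signed : signed_disturbance (wmin d);
  wmax_signed : signed_disturbance (wmax d);
  wmin_le_wmax : lew (wmin d) (wmax d);
  pmin_le_infeed : forall j, lemx (ren (pmin d)) (col j (infeed (wmin d)));
  Ct_ge0 : lemx 0 (Ct d);
  Con_ge0 : lemx 0 (Con d);
  Csw_ge0 : lemx 0 (Csw d);
  Cs_ge0 : lemx 0 (Cs d)
}.

Definition cost (p : units K nT nS nR N) (delta : 'M[bool]_(nT, N)) : K :=
  \sum_(j < N)
    (\sum_i Ct d i 0 * conv p i j
     + \sum_i Con d i 0 * (delta i j)%:R
     + \sum_i Csw d i 0
         * `|(delta i j)%:R - (delay (delta0 d) delta i j)%:R|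
     + \sum_i Cs d i 0 * stor p i j).

(* The constraints linking switch statuses, set-points and disturbance to
   powers p, stored energies x and the free scalars rho. *)
Definition constraints : Type :=
  'M[bool]_(nT, N) -> units K nT nS nR N -> disturbance K nR nD N ->
  units K nT nS nR N -> 'M[K]_(nS, N) -> 'rV[K]_N -> Prop.

Definition droop (u : units K nT nS nR N) (rho : 'rV[K]_N)
    : units K nT nS nR N :=
  Units (conv u + conv (chi d) *m rho)
        (stor u + stor (chi d) *m rho)
        (ren u + ren (chi d) *m rho).

Definition power_balance (p : units K nT nS nR N) (w : disturbance K nR nD N)
    : Prop :=
  forall j, 0 = usum p j + \sum_i load w i j.

Definition storage_dynamics (p : units K nT nS nR N) (x : 'M[K]_(nS, N))
    : Prop :=
  x = delay (x0 d) x - Ts d *: stor p.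

Record problemA (delta : 'M[bool]_(nT, N)) (u : units K nT nS nR N)
    (w : disturbance K nR nD N) (p : units K nT nS nR N)
    (x : 'M[K]_(nS, N)) (rho : 'rV[K]_N) : Prop := ProblemA {
  A_balance : power_balance p w;
  A_ren : forall i j,
    ren p i j = Num.min (ren (droop u rho) i j) (infeed w i j);
  A_conv : forall i j,
    conv p i j = gate (delta i j) (conv (droop u rho) i j);
  A_stor : forall i j, stor p i j = stor (droop u rho) i j;
  A_dynamics : storage_dynamics p x;
  A_conv_min : forall i j, gate (delta i j) (conv (pmin d) i 0) <= conv p i j;
  A_stor_min : forall i j, stor (pmin d) i 0 <= stor p i j;
  A_ren_min : forall i j, ren (pmin d) i 0 <= ren p i j;
  A_max : forall j, leu (ucol p j) (pmax d);
  A_energy : forall i j, xmin d i 0 <= x i j <= xmax d i 0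
}.

Definition stor_min (x : 'M[K]_(nS, N)) (i : 'I_nS) (j : 'I_N) : K :=
  Num.max (stor (pmin d) i 0) ((delay (x0 d) x i j - xmax d i 0) / Ts d).

Definition stor_max (x : 'M[K]_(nS, N)) (i : 'I_nS) (j : 'I_N) : K :=
  Num.min (stor (pmax d) i 0) ((delay (x0 d) x i j - xmin d i 0) / Ts d).

Record problemB (delta : 'M[bool]_(nT, N)) (u : units K nT nS nR N)
    (w : disturbance K nR nD N) (p : units K nT nS nR N)
    (x : 'M[K]_(nS, N)) (rho : 'rV[K]_N) : Prop := ProblemB {
  B_balance : power_balance p w;
  B_ren : forall i j,
    ren p i j = sat (ren (pmin d) i 0) (ren (droop u rho) i j) (infeed w i j);
  B_conv : forall i j,
    conv p i j = gate (delta i j)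
      (sat (conv (pmin d) i 0) (conv (droop u rho) i j) (conv (pmax d) i 0));
  B_stor : forall i j,
    stor p i j
    = sat (stor_min x i j) (stor (droop u rho) i j) (stor_max x i j);
  B_dynamics : storage_dynamics p x
}.

Definition setpoint_box (u : units K nT nS nR N) : Prop :=
  forall j, leu (umin d) (ucol u j) /\ leu (ucol u j) (umax d).

Definition disturbance_box (w : disturbance K nR nD N) : Prop :=
  lew (wmin d) w /\ lew w (wmax d).

Definition feasible (P : constraints) (delta : 'M[bool]_(nT, N))
    (u : units K nT nS nR N) : Prop :=
  setpoint_box u /\
  forall w, disturbance_box w -> exists p x rho, P delta u w p x rho.

Definition attained_costs (P : constraints) (delta : 'M[bool]_(nT, N))
    (u : units K nT nS nR N) : set K :=
  [set c | exists w p x rho,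
     [/\ disturbance_box w, P delta u w p x rho & c = cost p delta]].

(* c is the worst-case cost of (delta, u): a genuine maximum, not only a
   supremum. *)
Definition is_cost_value (P : constraints) (delta : 'M[bool]_(nT, N))
    (u : units K nT nS nR N) (c : K) : Prop :=
  attained_costs P delta u c /\ ubound (attained_costs P delta u) c.

End Problems.

(* Main.v *)
Require Import Defs.
From mathcomp Require Import all_boot all_order all_algebra.
From mathcomp Require Import all_classical all_reals.
From mathcomp Require Import lra.

(** Along a solution of Problem A the limits hold already, so the saturations of
    Problem B change nothing: the conventional and storage ones act as the
    identity (for storage by the energy limits, rewritten through the dynamics
    as bounds on the power), and the renewable one is the minimum of A.  Hence a
    solution of A solves B with the same powers, energies and [rho]
    ([problemA_problemB]).

    For the costs, the key fact is that at each instant every power is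
    nondecreasing in the single scalar [rho], while the power balance prescribes
    their sum.  Comparing two values of [rho], either the powers are ordered as
    wished, or they are ordered the other way and the balance forces them to be
    equal ([dispatch_le]).  This has two consequences.
    - Conventional and storage powers of B are determined by the disturbance, by
      induction on time because the storage bounds depend on the previous energy.
      Together with the inclusion above, A and B attain the same costs as soon
      as A is feasible ([attained_costs_AB]).
    - In A, conventional and storage powers are largest, entry by entry, for the
      least infeed and the largest consumption, that is, for [wmin d].  As the
      prices are nonnegative, the worst-case cost is attained at [wmin d]
      ([cost_value_A]).

    The converse inclusion fails for an instance whose conventional set-point 2
    exceeds the limit 1: B clips it, whereas A can only lower it by a negative
    [rho], which would make the renewable power negative. *)

Set Implicit Arguments.
Unset Strict Implicit.
Unset Printing Implicit Defensive.

Import Order.TTheory GRing.Theory Num.Theory.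

Local Open Scope classical_set_scope.
Local Open Scope ring_scope.

(** * Saturation *)

Section Saturation.
Variable K : realType.
Implicit Types a b z w : K.

Lemma sat_id a z b : a <= z <= b -> sat a z b = z.
Proof. by case/andP=> az zb; rewrite /sat ltNge az zb. Qed.

Lemma sat_min a z w : a <= Num.min z w -> sat a z w = Num.min z w.
Proof. by rewrite le_min /sat minEle => /andP[az _]; rewrite ltNge az. Qed.

Lemma le_sat a b z z' : a <= b -> z <= z' -> sat a z b <= sat a z' b.
Proof.
by rewrite /sat; case: (ltP z a); case: (ltP z' a); case: (leP z b);
  case: (leP z' b); lra.
Qed.

Lemma le_gate (c : bool) z z' : z <= z' -> gate c z <= gate c z'.
Proof. by case: c. Qed.

End Saturation.

(** * Comparing the powers at one instant *)

Lemma sub_le_sum (K : realType) n (f g : 'I_n -> K) i :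
  (forall k, f k <= g k) -> g i - f i <= \sum_k g k - \sum_k f k.
Proof.
move=> fg; rewrite -sumrB (bigD1 i) //= lerDl.
by apply: sumr_ge0 => k _; rewrite subr_ge0.
Qed.

(** The renewable powers are absent from the first hypothesis and from the
    conclusion because a larger [rho] does not raise them when the infeed
    decreases at the same time. *)
Lemma dispatch_le (K : realType) nT nS nR N (p p' : units K nT nS nR N)
    (j : 'I_N) (rho rho' : K) :
  (rho <= rho' -> (forall i, conv p i j <= conv p' i j) /\
                  (forall i, stor p i j <= stor p' i j)) ->
  (rho' <= rho -> [/\ forall i, conv p' i j <= conv p i j,
                      forall i, stor p' i j <= stor p i j &
                      forall i, ren p' i j <= ren p i j]) ->
  usum p j <= usum p' j ->
  (forall i, conv p i j <= conv p' i j) /\ (forall i, stor p i j <= stor p' i j).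
Proof.
move=> le_p ge_p; rewrite /usum => le_sum.
have [/le_p //|/ltW/ge_p[ge_conv ge_stor ge_ren]] := leP rho rho'.
have sum_conv : \sum_i conv p' i j <= \sum_i conv p i j by apply: ler_sum.
have sum_stor : \sum_i stor p' i j <= \sum_i stor p i j by apply: ler_sum.
have sum_ren : \sum_i ren p' i j <= \sum_i ren p i j by apply: ler_sum.
split=> i.
- by have := sub_le_sum i ge_conv; lra.
- by have := sub_le_sum i ge_stor; lra.
Qed.

(** * Trajectories *)

Lemma delay0 (A : Type) m N (a0 : 'cV[A]_m) (M : 'M[A]_(m, N)) i (j : 'I_N) :
  j = 0%N :> nat -> delay a0 M i j = a0 i 0.
Proof.
move=> j0; rewrite mxE.
have -> : widen_ord (leqnSn N) j = lshift N (0 : 'I_1) by apply/val_inj.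
by rewrite (row_mxEl a0 M).
Qed.

Lemma delayS (A : Type) m N (a0 : 'cV[A]_m) (M : 'M[A]_(m, N)) i (j k : 'I_N) :
  j = k.+1 :> nat -> delay a0 M i j = M i k.
Proof.
move=> jk; rewrite mxE.
have -> : widen_ord (leqnSn N) j = rshift 1 k by apply/val_inj.
by rewrite (row_mxEr a0 M).
Qed.

Lemma delay_ind (A : Type) m N (a0 : 'cV[A]_m) (M : 'M[A]_(m, N))
    (P : 'I_m -> A -> Prop) :
  (forall i, P i (a0 i 0)) -> (forall i j, P i (M i j)) ->
  forall i j, P i (delay a0 M i j).
Proof.
move=> P0 PM i [[|k] lt_kN]; first by rewrite delay0.
by rewrite (delayS _ _ _ (k := Ordinal (ltnW lt_kN))).
Qed.

Lemma col_mul_rowE (K : realType) m N (c : 'cV[K]_m) (rho : 'rV[K]_N) i j :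
  (c *m rho) i j = c i 0 * rho 0 j.
Proof. by rewrite mxE big_ord1. Qed.

Section Problems.
Variables (K : realType) (nT nS nR nD N : nat).
Variable d : mpc_data K nT nS nR nD N.
Hypothesis wpd : well_posed d.
Variables (delta : 'M[bool]_(nT, N)) (u : units K nT nS nR N).
Implicit Types (w : disturbance K nR nD N) (p : units K nT nS nR N).
Implicit Types (x : 'M[K]_(nS, N)) (rho : 'rV[K]_N).

Lemma le_droop rho rho' j : rho 0 j <= rho' 0 j ->
  [/\ forall i, conv (droop d u rho) i j <= conv (droop d u rho') i j,
      forall i, stor (droop d u rho) i j <= stor (droop d u rho') i j &
      forall i, ren (droop d u rho) i j <= ren (droop d u rho') i j].
Proof.
move=> le_rho; have [chiT chiS chiR] := chi_ge0 wpd.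
split=> i; rewrite mxE [leRHS]mxE !col_mul_rowE lerD2l ler_wpM2l //.
- by have := chiT i 0; rewrite mxE.
- by have := chiS i 0; rewrite mxE.
- by have := chiR i 0; rewrite mxE.
Qed.

Lemma storage_dynamicsE p x i j : storage_dynamics d p x ->
  x i j = delay (x0 d) x i j - Ts d * stor p i j.
Proof. by move=> dyn; rewrite [in LHS]dyn !mxE. Qed.

Lemma pmin_ren_le_infeed w i j :
  disturbance_box d w -> ren (pmin d) i 0 <= infeed w i j.
Proof.
case=> [[le_infeed _] _]; apply: le_trans (le_infeed i j).
by have := pmin_le_infeed wpd j i 0; rewrite mxE.
Qed.

(** * Solutions of Problem A solve Problem B *)

Lemma A_energy_before w p x rho i j : problemA d delta u w p x rho ->
  xmin d i 0 <= delay (x0 d) x i j <= xmax d i 0.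
Proof.
move=> solA.
apply: (delay_ind (P := fun i y => xmin d i 0 <= y <= xmax d i 0)).
- by move=> k; rewrite (xmin_le_x0 wpd) (x0_le_xmax wpd).
- exact: A_energy solA.
Qed.

(** With [x i j = x' - Ts * p], where [x'] is the previous energy, the energy
    limits on [x i j] say exactly that [p] lies between [(x' - xmax) / Ts] and
    [(x' - xmin) / Ts]. *)
Lemma A_stor_limits w p x rho i j : problemA d delta u w p x rho ->
  stor_min d x i j <= stor p i j <= stor_max d x i j.
Proof.
move=> solA; have Ts0 := Ts_gt0 wpd.
have /andP[x_min x_max] := A_energy solA i j.
have x_step := storage_dynamicsE i j (A_dynamics solA).
have [_ p_max _] := A_max solA j; have := p_max i 0; rewrite mxE => {}p_max.
rewrite /stor_min /stor_max ge_max le_min p_max (A_stor_min solA) /=.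
rewrite ler_pdivrMr // ler_pdivlMr // [stor p i j * _]mulrC.
by apply/andP; split; lra.
Qed.

Lemma problemA_problemB w p x rho :
  problemA d delta u w p x rho -> problemB d delta u w p x rho.
Proof.
move=> solA; split.
- exact: A_balance solA.
- move=> i j; rewrite (A_ren solA) sat_min // -(A_ren solA).
  exact: A_ren_min solA i j.
- move=> i j; have [p_max _ _] := A_max solA j.
  have := p_max i 0; have := A_conv_min solA i j.
  rewrite mxE (A_conv solA); case: (delta i j) => //= p_min {}p_max.
  by rewrite sat_id // p_min p_max.
- move=> i j; rewrite -(A_stor solA) sat_id //.
  exact: A_stor_limits solA.
- exact: A_dynamics solA.
Qed.

Lemma feasibleA_feasibleB :
  feasible d (problemA d) delta u -> feasible d (problemB d) delta u.
Proof.
case=> boxu solA; split=> // w /solA[p [x [rho sol]]].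
by exists p, x, rho; apply: problemA_problemB.
Qed.

(** * Problems A and B attain the same costs *)

(** The step of the induction on time: equal past energies give equal storage
    bounds, so that all powers are the same functions of [rho]. *)
Lemma B_powers_le w p x rho p' x' rho' j :
  disturbance_box d w ->
  (forall i, stor_min d x i j <= stor_max d x i j) ->
  (forall i, delay (x0 d) x i j = delay (x0 d) x' i j) ->
  problemB d delta u w p x rho -> problemB d delta u w p' x' rho' ->
  (forall i, conv p i j <= conv p' i j) /\ (forall i, stor p i j <= stor p' i j).
Proof.
move=> boxw le_bounds eq_past sol sol'.
have [pminT _ _] := pmin_le_pmax wpd.
have eq_min i : stor_min d x' i j = stor_min d x i j.
  by rewrite /stor_min eq_past.
have eq_max i : stor_max d x' i j = stor_max d x i j.
  by rewrite /stor_max eq_past.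
apply: (dispatch_le (rho := rho 0 j) (rho' := rho' 0 j)).
- move=> /le_droop[leT leS _]; split=> i.
  + by rewrite (B_conv sol) (B_conv sol') le_gate // le_sat.
  + by rewrite (B_stor sol) (B_stor sol') eq_min eq_max le_sat.
- move=> /le_droop[leT leS leR]; split=> i.
  + by rewrite (B_conv sol) (B_conv sol') le_gate // le_sat.
  + by rewrite (B_stor sol) (B_stor sol') eq_min eq_max le_sat.
  + by rewrite (B_ren sol) (B_ren sol') le_sat // pmin_ren_le_infeed.
- by have := B_balance sol j; have := B_balance sol' j; lra.
Qed.

Lemma B_powers_eq w p x rho p' x' rho' j :
  disturbance_box d w ->
  (forall i, stor_min d x i j <= stor_max d x i j) ->
  (forall i, delay (x0 d) x i j = delay (x0 d) x' i j) ->
  problemB d delta u w p x rho -> problemB d delta u w p' x' rho' ->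
  (forall i, conv p i j = conv p' i j) /\ (forall i, stor p i j = stor p' i j).
Proof.
move=> boxw le_bounds eq_past sol sol'.
have [leT leS] := B_powers_le boxw le_bounds eq_past sol sol'.
have le_bounds' i : stor_min d x' i j <= stor_max d x' i j.
  by have := le_bounds i; rewrite /stor_min /stor_max eq_past.
have [geT geS] :=
  B_powers_le boxw le_bounds' (fun i => esym (eq_past i)) sol' sol.
by split=> i; apply/le_anti; rewrite ?leT ?geT ?leS ?geS.
Qed.

(** Taking one of the two solutions from A provides the ordering of the storage
    bounds at every instant. *)
Lemma B_powers_unique w p x rho p' x' rho' :
  disturbance_box d w ->
  problemA d delta u w p x rho -> problemB d delta u w p' x' rho' ->
  conv p = conv p' /\ stor p = stor p'.
Proof.
move=> boxw solA sol'; have sol := problemA_problemB solA.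
have le_bounds j i : stor_min d x i j <= stor_max d x i j.
  by have /andP[/le_trans h /h] := A_stor_limits i j solA.
have eq_past n : forall j : 'I_N, j = n :> nat ->
    forall i, delay (x0 d) x i j = delay (x0 d) x' i j.
  elim: n => [|n IHn] j jn i; first by rewrite !delay0.
  have lt_nN : (n < N)%N by apply: ltnW; rewrite -jn.
  rewrite !(delayS _ _ _ (k := Ordinal lt_nN)) //.
  rewrite (storage_dynamicsE _ _ (B_dynamics sol)).
  rewrite (storage_dynamicsE _ _ (B_dynamics sol')).
  have eq_n := IHn (Ordinal lt_nN) erefl.
  by have [_ ->] := B_powers_eq boxw (le_bounds _) eq_n sol sol'; rewrite eq_n.
have eq_p j := B_powers_eq boxw (le_bounds j) (eq_past _ j erefl) sol sol'.
by split; apply/matrixP => i j; case: (eq_p j).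
Qed.

Lemma eq_cost p p' : conv p = conv p' -> stor p = stor p' ->
  cost d p delta = cost d p' delta.
Proof. by rewrite /cost => -> ->. Qed.

Lemma attained_costs_AB : feasible d (problemA d) delta u ->
  attained_costs d (problemB d) delta u = attained_costs d (problemA d) delta u.
Proof.
case=> _ existsA; apply/seteqP; split=> c /= [w [p [x [rho [boxw sol ->]]]]].
  have [p' [x' [rho' solA]]] := existsA _ boxw.
  exists w, p', x', rho'; split=> //.
  by apply/esym/eq_cost; have [] := B_powers_unique boxw solA sol.
by exists w, p, x, rho; split=> //; apply: problemA_problemB.
Qed.

(** * The worst case of Problem A *)

(** A smaller infeed or a larger consumption calls for a larger [rho], and
    conventional and storage powers increase with [rho]. *)
Lemma A_powers_antimono w p x rho w' p' x' rho' :
  lew w' w -> problemA d delta u w p x rho -> problemA d delta u w' p' x' rho' ->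
  lemx (conv p) (conv p') /\ lemx (stor p) (stor p').
Proof.
case=> le_infeed le_load sol sol'.
suff le_p j : (forall i, conv p i j <= conv p' i j) /\
              (forall i, stor p i j <= stor p' i j).
  by split=> i j; case: (le_p j).
apply: (dispatch_le (rho := rho 0 j) (rho' := rho' 0 j)).
- move=> /le_droop[leT leS _]; split=> i.
  + by rewrite (A_conv sol) (A_conv sol') le_gate.
  + by rewrite (A_stor sol) (A_stor sol').
- move=> /le_droop[leT leS leR]; split=> i.
  + by rewrite (A_conv sol) (A_conv sol') le_gate.
  + by rewrite (A_stor sol) (A_stor sol').
  + by rewrite (A_ren sol) (A_ren sol') le_min !ge_min leR le_infeed orbT.
- have := B_balance (problemA_problemB sol) j.
  have := B_balance (problemA_problemB sol') j.
  have : \sum_i load w' i j <= \sum_i load w i j by apply: ler_sum.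
  lra.
Qed.

Lemma le_cost p p' : lemx (conv p) (conv p') -> lemx (stor p) (stor p') ->
  cost d p delta <= cost d p' delta.
Proof.
move=> leT leS; apply: ler_sum => j _.
apply: lerD; [apply: lerD => //; apply: lerD => //|];
  apply: ler_sum => i _; apply: ler_wpM2l => //.
- by have := Ct_ge0 wpd i 0; rewrite mxE.
- by have := Cs_ge0 wpd i 0; rewrite mxE.
Qed.

Lemma cost_value_A : feasible d (problemA d) delta u ->
  exists c, is_cost_value d (problemA d) delta u c.
Proof.
case=> _ existsA.
have box_wmin : disturbance_box d (wmin d).
  by split; [split=> i j | exact: wmin_le_wmax wpd].
have [p' [x' [rho' sol']]] := existsA _ box_wmin.
exists (cost d p' delta); split; first by exists (wmin d), p', x', rho'.
move=> c /= [w [p [x [rho [[ge_wmin _] sol ->]]]]].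
by have [] := A_powers_antimono ge_wmin sol sol'; apply: le_cost.
Qed.

Lemma cost_value_AB : feasible d (problemA d) delta u ->
  exists c, is_cost_value d (problemA d) delta u c /\
            is_cost_value d (problemB d) delta u c.
Proof.
move=> feasA; have [c cA] := cost_value_A feasA.
by exists c; split; rewrite // /is_cost_value attained_costs_AB.
Qed.

End Problems.

(** * An instance feasible for Problem B only *)

Section Instance.
Variable K : realType.

(** An empty storage unit and a zero infeed leave only the conventional unit to
    feed the unit load.  Set-point and disturbance boxes are single points, so
    that feasibility concerns one set-point and one disturbance. *)
Definition overload_data : mpc_data K 1 1 1 1 1 :=
  MpcData 1 (Units (const_mx 1) (const_mx 1) (const_mx 1))
    (Units 0 (const_mx (-1)) 0)
    (Units (const_mx 1) (const_mx 1) (const_mx 1))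
    0 (const_mx 1)
    (Units (const_mx 2) 0 0) (Units (const_mx 2) 0 0)
    0 (const_mx true)
    (Disturbance 0 (const_mx (-1))) (Disturbance 0 (const_mx (-1)))
    0 0 0 0.

Definition overload_setpoint : units K 1 1 1 1 := Units (const_mx 2) 0 0.

Lemma overload_well_posed : well_posed overload_data.
Proof.
split; rewrite /leu /lew /signed_disturbance /lemx /ltmx /=;
  by do ?[split]; move=> *; rewrite ?mxE; lra.
Qed.

(** With [rho = 0] the clipped conventional unit feeds the whole load. *)
Lemma overload_feasibleB :
  feasible overload_data (problemB overload_data) (const_mx true)
    overload_setpoint.
Proof.
split; first by move=> j; split; split=> i k; rewrite !mxE.
move=> w [[/= infeed_ge load_ge] [/= infeed_le load_le]].
have infeed0 i j : infeed w i j = 0.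
  by apply/le_anti; have := infeed_ge i j; have := infeed_le i j;
     rewrite mxE => -> ->.
have load1 i j : load w i j = -1.
  by apply/le_anti; have := load_ge i j; have := load_le i j;
     rewrite mxE => -> ->.
exists (Units (const_mx 1) 0 0), 0, 0; split=> /=.
- by move=> j; rewrite /usum !big_ord1 /= load1 !mxE; lra.
- by move=> i j; rewrite infeed0 mulmx0 !mxE sat_id //; lra.
- move=> i j; rewrite mulmx0 !mxE /= /sat.
  by case: ltP => [|_]; [lra | case: leP => //; lra].
- move=> i j; rewrite mulmx0 !mxE /stor_min /stor_max delay0 ?(ord1 j) //=.
  rewrite !mxE sat_id; first by lra.
  by rewrite ge_max le_min; lra.
- apply/matrixP => i j; rewrite ord1 (ord1 j) mxE [RHS]mxE delay0 // !mxE; lra.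
Qed.

(** The limit on the conventional unit forces [rho <= -1], and the sign of the
    renewable power forces [rho >= 0]. *)
Lemma overload_not_feasibleA :
  ~ feasible overload_data (problemA overload_data) (const_mx true)
      overload_setpoint.
Proof.
case=> _ /(_ (wmin overload_data)) [].
  by split; split=> i j; rewrite !mxE.
move=> p [x [rho sol]].
have [conv_max _ _] := A_max sol 0.
have := conv_max 0 0; rewrite mxE (A_conv sol).
have := A_ren_min sol 0 0; rewrite (A_ren sol) le_min /=.
rewrite !mxE !big_ord1 !mxE.
by move=> /andP[] /=; lra.
Qed.

End Instance.

Theorem theorem3 (K : realType) :
  [/\ (forall (nT nS nR nD N : nat) (d : mpc_data K nT nS nR nD N)
         (delta : 'M[bool]_(nT, N)) (u : units K nT nS nR N),
         well_posed d ->
         feasible d (problemA d) delta u -> feasible d (problemB d) delta u),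
      (exists (nT nS nR nD N : nat) (d : mpc_data K nT nS nR nD N)
         (delta : 'M[bool]_(nT, N)) (u : units K nT nS nR N),
         [/\ (0 < nT)%N, (0 < nS)%N, (0 < nR)%N, (0 < nD)%N & (0 < N)%N] /\
         [/\ well_posed d,
             feasible d (problemB d) delta u &
             ~ feasible d (problemA d) delta u]) &
      (forall (nT nS nR nD N : nat) (d : mpc_data K nT nS nR nD N)
         (delta : 'M[bool]_(nT, N)) (u : units K nT nS nR N),
         well_posed d ->
         feasible d (problemA d) delta u -> feasible d (problemB d) delta u ->
         exists c : K,
           is_cost_value d (problemA d) delta u c /\
           is_cost_value d (problemB d) delta u c)].
Proof.
split.
- by move=> nT nS nR nD N d delta u wpd; apply: feasibleA_feasibleB.
- exists 1, 1, 1, 1, 1, (overload_data K), (const_mx true), (overload_setpoint K).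
  split=> //; split.
  + exact: overload_well_posed.
  + exact: overload_feasibleB.
  + exact: overload_not_feasibleA.
- by move=> nT nS nR nD N d delta u wpd feasA _; apply: cost_value_AB.
Qed.
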